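(* Let $\mathcal P$ be a 2-unitary operad over the field $\Bbbk$ that is locally finite. (1) If $\operatorname{GKdim}\mathcal P<\infty$, then $\mathcal P$ is noetherian. (2) $\operatorname{GKdim}\mathcal P<\infty$ if and only if $\mathcal P$ is artinian. (3) If $\mathcal P$ is artinian, then it is noetherian.
   Context: Fix a field $\Bbbk$; all operads are $\Bbbk$-linear symmetric operads (right $\mathbb S_n$-action $*$ on $\mathcal P(n)$, identity $\mathbf 1\in\mathcal P(1)$, compositions $\theta\circ(\theta_1,\dots,\theta_n)$ with the usual unit, associativity and equivariance axioms). $\mathcal P$ is unitary if $\mathcal P(0)=\Bbbk\mathbf 1_0\cong\Bbbk$ with a fixed basis element $\mathbf 1_0$. $\mathcal P$ is 2-unitary if it is unitary and there is $\mathbf 1_2\in\mathcal P(2)$ with $\mathbf 1_2\circ(\mathbf 1_0,\mathbf 1)=\mathbf 1=\mathbf 1_2\circ(\mathbf 1,\mathbf 1_0)$. $\mathcal P$ is locally finite if $\dim_\Bbbk\mathcal P(n)<\infty$ for all $n\ge0$. An ideal $\mathcal I$ of $\mathcal P$ is a family of $\mathbb S_n$-submodules $\mathcal I(n)\subseteq\mathcal P(n)$ such that $\theta\circ(\theta_1,\dots,\theta_n)\in\mathcal I$ whenever at least one of $\theta,\theta_1,\dots,\theta_n$ is in $\mathcal I$. $\mathcal P$ is artinian (respectively, noetherian) if the set of ideals of $\mathcal P$ satisfies the descending (respectively, ascending) chain condition. $\operatorname{GKdim}\mathcal P=\limsup_{n\to\infty}\log_n\big(\sum_{i=0}^n\dim_\Bbbk\mathcal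 P(i)\big)$. *)

(* Defs.v *)
From mathcomp Require Import all_boot all_order all_algebra all_fingroup.
From mathcomp Require Import all_classical all_reals all_analysis.

Set Implicit Arguments.
Unset Strict Implicit.
Unset Printing Implicit Defensive.

Import Order.TTheory GRing.Theory Num.Theory.

(* A composite theta o (theta_1, ..., theta_n) with theta_i of arity a i has
   arity \sum_i a i.  Its inputs are the pairs (i, j) with j : 'I_(a i), in
   lexicographic order; tagnat.Rank i j is the position of the pair (i, j). *)

Section Arities.
Local Open Scope nat_scope.

Lemma sum_const1 m : \sum_(i < 1) m = m.
Proof. by rewrite big_ord1. Qed.

Lemma sum_ones n : \sum_(i < n) 1 = n.
Proof. by rewrite sum1_card card_ord. Qed.

Lemma sum_Rank n (a : 'I_n -> nat) (c : 'I_(\sum_i a i) -> nat) :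
  \sum_p c p = \sum_i \sum_j c (tagnat.Rank (p_ := a) i j).
Proof.
rewrite (reindex _ (tagnat.rank_bij_on (p_ := a))) /=.
rewrite [RHS]sig_big_dep /=.
by apply: eq_bigr => -[i j] _.
Qed.

Lemma sum_perm n (s : 'S_n) (a : 'I_n -> nat) :
  \sum_i a (s i) = \sum_i a i.
Proof. by rewrite [RHS](reindex_inj (@perm_inj _ s)). Qed.

Definition arity2 (m n : nat) (i : 'I_2) : nat := if i == ord0 then m else n.

Lemma sum_arity2 m n : \sum_i arity2 m n i = m + n.
Proof. by rewrite big_ord_recl big_ord1. Qed.

(* Position (i, j) of the arities a \o s is sent to position (s i, j) of a. *)
Definition block_perm_fun n (s : 'S_n) (a : 'I_n -> nat)
    (p : 'I_(\sum_i a i)) : 'I_(\sum_i a i) :=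
  let q := tagnat.sig (p_ := fun i => a (s i))
                      (cast_ord (esym (sum_perm s a)) p) in
  tagnat.Rank (p_ := a) (s (tag q)) (tagged q).

Lemma block_perm_inj n (s : 'S_n) (a : 'I_n -> nat) :
  injective (block_perm_fun s (a := a)).
Proof.
move=> p p' /(@tagnat.rank_inj _ a) e.
suff /tagnat.sig_inj /cast_ord_inj :
    tagnat.sig (p_ := fun i => a (s i)) (cast_ord (esym (sum_perm s a)) p)
  = tagnat.sig (p_ := fun i => a (s i)) (cast_ord (esym (sum_perm s a)) p').
  by [].
move: (tagnat.sig _) (tagnat.sig _) e => [i' j'] [i j] /= e.
have /perm_inj ei := congr1 tag e; case: _ / ei in j' e *.
by congr Tagged; apply/eqP; move/eqP: e; rewrite eq_Tagged.
Qed.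

Definition block_perm n (s : 'S_n) (a : 'I_n -> nat) : 'S_(\sum_i a i) :=
  perm (@block_perm_inj n s a).

(* Position (i, j) is sent to position (i, t i j). *)
Definition sum_perms_fun n (a : 'I_n -> nat) (t : forall i, 'S_(a i))
    (p : 'I_(\sum_i a i)) : 'I_(\sum_i a i) :=
  tagnat.Rank (p_ := a) (tagnat.sig1 p) (t _ (tagnat.sig2 p)).

Lemma sum_perms_inj n (a : 'I_n -> nat) (t : forall i, 'S_(a i)) :
  injective (sum_perms_fun t).
Proof.
move=> p p' /(@tagnat.rank_inj _ a); rewrite /tagnat.sig2 /tagnat.sig1 => e.
apply: (@tagnat.sig_inj _ a).
move: (tagnat.sig p) (tagnat.sig p') e => [i j] [i' j'] /= e.
have /= ei := congr1 tag e; case: _ / ei in j' e *.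
by congr Tagged; apply: (@perm_inj _ (t i)); apply/eqP; move/eqP: e;
  rewrite eq_Tagged.
Qed.

Definition sum_perms n (a : 'I_n -> nat) (t : forall i, 'S_(a i)) :
    'S_(\sum_i a i) :=
  perm (@sum_perms_inj n a t).

End Arities.

Definition cast_arity (P : nat -> Type) (m n : nat) (e : m = n) (x : P m) :
  P n := ecast i (P i) e x.

Local Open Scope ring_scope.

(* In 'S_n the product s * t is "first s, then t", and operad_act is a right
   action for this product.  The convention in operad_comp_actl is the one of
   the endomorphism operad with
     (theta * s) (x_1, ..., x_n) = theta (x_(s 1), ..., x_(s n)).
   Replacing s by its inverse gives the convention in which permutations
   compose as functions. *)
Record operad (k : fieldType) (P : nat -> lmodType k) := Operad {
  operad_act : forall n, P n -> 'S_n -> P n;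
  operad_one : P 1%N;
  operad_comp : forall n (a : 'I_n -> nat),
    P n -> (forall i, P (a i)) -> P (\sum_i a i)%N;

  operad_act_linear : forall n (s : 'S_n) (c : k) (x y : P n),
    operad_act (c *: x + y) s = c *: operad_act x s + operad_act y s;
  operad_act1 : forall n (x : P n), operad_act x 1%g = x;
  operad_actM : forall n (x : P n) (s t : 'S_n),
    operad_act x (s * t)%g = operad_act (operad_act x s) t;

  operad_comp_linearl : forall n (a : 'I_n -> nat) (c : k) (x y : P n)
      (z : forall i, P (a i)),
    operad_comp (c *: x + y) z = c *: operad_comp x z + operad_comp y z;
  operad_comp_linearr : forall n (a : 'I_n -> nat) (x : P n)
      (z : forall i, P (a i)) (i : 'I_n) (c : k) (u v : P (a i)),
    operad_comp x (eqtype.dfwith z (c *: u + v))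
    = c *: operad_comp x (eqtype.dfwith z u) + operad_comp x (eqtype.dfwith z v);

  operad_comp1l : forall m (x : P m),
    cast_arity (P := P) (sum_const1 m)
      (operad_comp (a := fun _ : 'I_1 => m) operad_one (fun=> x)) = x;
  operad_comp1r : forall n (x : P n),
    cast_arity (P := P) (sum_ones n)
      (operad_comp (a := fun _ : 'I_n => 1%N) x (fun=> operad_one)) = x;

  operad_compA : forall n (a : 'I_n -> nat) (c : 'I_(\sum_i a i)%N -> nat)
      (x : P n) (y : forall i, P (a i)) (z : forall p, P (c p)),
    cast_arity (P := P) (sum_Rank c) (operad_comp (operad_comp x y) z)
    = operad_comp x
        (fun i => operad_comp (y i) (fun j => z (tagnat.Rank (p_ := a) i j)));

  operad_comp_actl : forall n (a : 'I_n -> nat) (x : P n) (s : 'S_n)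
      (y : forall i, P (a i)),
    operad_comp (operad_act x s) y
    = operad_act
        (cast_arity (P := P) (sum_perm s a) (operad_comp x (fun i => y (s i))))
        (block_perm s a);
  operad_comp_actr : forall n (a : 'I_n -> nat) (x : P n)
      (y : forall i, P (a i)) (t : forall i, 'S_(a i)),
    operad_comp x (fun i => operad_act (y i) (t i))
    = operad_act (operad_comp x y) (sum_perms t)
}.

Section OperadTheory.
Variables (k : fieldType) (P : nat -> lmodType k) (O : operad P).

Definition pair_op m n (x : P m) (y : P n) (i : 'I_2) : P (arity2 m n i) :=
  if i == ord0 as b return P (if b then m else n) then x else y.

Definition comp2 m n (w : P 2) (x : P m) (y : P n) : P (m + n)%N :=
  cast_arity (P := P) (sum_arity2 m n) (operad_comp O w (pair_op x y)).

Definition two_unitary : Prop :=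
  exists (one0 : P 0%N) (one2 : P 2),
    [/\ forall x : P 0%N, exists! c : k, x = c *: one0,
        comp2 one2 one0 (operad_one O) = operad_one O
      & comp2 one2 (operad_one O) one0 = operad_one O].

Record operad_ideal := OperadIdeal {
  in_ideal :> forall n, P n -> Prop;
  ideal0 : forall n, in_ideal (0 : P n);
  ideal_linear : forall n (c : k) (x y : P n),
    in_ideal x -> in_ideal y -> in_ideal (c *: x + y);
  ideal_act : forall n (x : P n) (s : 'S_n),
    in_ideal x -> in_ideal (operad_act O x s);
  ideal_compl : forall n (a : 'I_n -> nat) (x : P n) (y : forall i, P (a i)),
    in_ideal x -> in_ideal (operad_comp O x y);
  ideal_compr : forall n (a : 'I_n -> nat) (x : P n) (y : forall i, P (a i))
      (i : 'I_n),
    in_ideal (y i) -> in_ideal (operad_comp O x y)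
}.

Definition ideal_sub (I J : operad_ideal) : Prop :=
  forall n (x : P n), I n x -> J n x.

Definition ideal_eq (I J : operad_ideal) : Prop :=
  forall n (x : P n), I n x <-> J n x.

Definition noetherian : Prop :=
  forall I : nat -> operad_ideal,
    (forall m, ideal_sub (I m) (I m.+1)) ->
    exists N, forall m, (N <= m)%N -> ideal_eq (I m) (I N).

Definition artinian : Prop :=
  forall I : nat -> operad_ideal,
    (forall m, ideal_sub (I m.+1) (I m)) ->
    exists N, forall m, (N <= m)%N -> ideal_eq (I m) (I N).

End OperadTheory.

(* vectType carriers encode local finiteness.  The terms n = 0, 1, where log_n is
   undefined, do not affect the limsup. *)
Definition GKdim (R : realType) (k : fieldType) (P : nat -> vectType k) :
    \bar R :=
  limn_esup (fun n =>
    (ln (\sum_(i < n.+1) \dim {:P i})%N%:R / ln n%:R)%:E).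

(* Main.v *)
From HB Require Import structures.
Require Import Defs.
From mathcomp Require Import all_boot all_order all_algebra all_fingroup.
From mathcomp Require Import all_classical all_reals all_analysis.
From mathcomp Require Import zify.

Set Implicit Arguments.
Unset Strict Implicit.
Unset Printing Implicit Defensive.

Import Order.TTheory GRing.Theory Num.Theory.
Local Open Scope ring_scope.

(** Finite GKdim and the artinian property are both equivalent to one condition,
    which also implies the noetherian property: in large arity, an operation
    that dies as soon as one of its inputs other than the last is fed 1_0 must
    be zero.

    Feeding 1_0 to input j lowers the arity by one ([close_input]), and feeding
    1_2 to input j raises it by one ([double_input]).  The unit law
    1_2 o (1_0, 1) = 1 makes the first a left inverse of the second.  Let
    V(n, j) be the space of operations of arity n + 1 that vanish as soon as
    one of the inputs 0, ..., j - 1 is fed 1_0.  Both maps respect these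
    conditions, so closing input j splits off V(n, j) from V(n + 1, j), with
    kernel V(n + 1, j + 1).  Peeling inputs off one by one reduces everything
    to the spaces V(i, i); say that the operad has depth at most N when
    V(i, i) = 0 for every i >= N.

    - Ideals are stable under both maps, so at depth at most N two nested
      ideals that agree in arities at most N are equal
      ([ideal_determined]).  Finite dimension in these arities then gives both
      chain conditions ([depth_noetherian], [depth_artinian]).
    - Operations killed by every composition of total arity below d form an
      ideal, the d-th truncation ideal.  These ideals decrease, the d-th one is
      zero in arities below d and contains V(d, d).  If the chain is
      stationary, then V(i, i) = 0 for large i ([artinian_depth]).
    - The splittings obey the recursion of the Pascal triangle, whence
      dim P(n + 1) = \sum_i C(n, i) dim V(i, i) ([dim_operad_binomial]).  The
      right-hand side is polynomially bounded exactly when almost all V(i, i)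
      vanish ([depth_polynomial], [polynomial_depth]), and GKdim is finite
      exactly when the dimensions are polynomially bounded
      ([GKdim_lt_pinfty]).

    When input j is closed, the next input takes its place, and it is this one
    that is doubled.  It always exists because the peeling stops at V(i, i),
    whose operations still have one unconstrained input.  So 1_2 only ever has
    to be plugged into other operations, and the symmetric group action occurs
    only in the definition of ideals. *)

(** * Composition on the total space of an operad *)

Section Operations.
Variables (k : fieldType) (P : nat -> lmodType k) (O : operad P).

Lemma operad_comp0l n (a : 'I_n -> nat) (y : forall i, P (a i)) :
  operad_comp O 0 y = 0.
Proof.
by have := operad_comp_linearl O (-1) 0 0 y; rewrite !scaleN1r !addNr.
Qed.

(** Composites have arities that are sums, equal only up to a proof.  Pairing
    each element with its arity turns the operad axioms into plain equations
    between elements of one type, with no casts. *)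
Definition operation := {n : nat & P n}.
Definition op n (x : P n) : operation := existT (fun n => P n : Type) n x.
Definition arity (X : operation) : nat := tag X.
Definition null (X : operation) : Prop := tagged X = 0.

Definition plug_family n (x : P n) (z : 'I_n -> operation) : operation :=
  op (operad_comp O (a := fun i => arity (z i)) x (fun i => tagged (z i))).

(** Inputs are indexed by [nat], so that shifting them needs no bound
    proofs. *)
Definition plug (X : operation) (z : nat -> operation) : operation :=
  plug_family (tagged X) (fun i => z i).

Lemma op_inj n : injective (@op n).
Proof. by move=> x y e; apply/eqP; move/eqP: e; rewrite eq_Tagged. Qed.

Lemma op_cast m n (e : m = n) (x : P m) :
  op (cast_arity (P := P) e x) = op x.
Proof. by case: _ / e. Qed.

Lemma null_op n (x : P n) (X : operation) : X = op x -> null X <-> x = 0.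
Proof. by move->. Qed.

Lemma arity_plug X z : arity (plug X z) = (\sum_(i < arity X) arity (z i))%N.
Proof. by []. Qed.

Lemma eq_plug X z z' :
  (forall i, (i < arity X)%N -> z i = z' i) -> plug X z = plug X z'.
Proof.
move=> e; rewrite /plug; congr plug_family.
by apply/funext => i; apply: e.
Qed.

Lemma plug_one X : plug X (fun=> op (operad_one O)) = X.
Proof.
case: X => n x; rewrite -[RHS](congr1 (@op n) (operad_comp1r O x)).
by rewrite op_cast.
Qed.

Lemma one_plug z : plug (op (operad_one O)) z = z 0%N.
Proof.
have -> : plug (op (operad_one O)) z = plug (op (operad_one O)) (fun=> z 0%N).
  by apply: eq_plug => -[].
case: (z 0%N) => n x; rewrite -[RHS](congr1 (@op n) (operad_comp1l O x)).
by rewrite op_cast.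
Qed.

Lemma plugA X y z :
  plug (plug X y) z
  = plug X (fun i => plug (y i)
      (fun j => z (\sum_(l < i) arity (y l) + j)%N)).
Proof.
rewrite [LHS]/plug /plug_family /=.
rewrite -(op_cast (sum_Rank _)) operad_compA.
transitivity (plug_family (tagged X) (fun i : 'I_(tag X) =>
    plug_family (tagged (y i)) (fun j : 'I_(tag (y i)) =>
      z (tagnat.Rank (p_ := fun i : 'I_(tag X) => arity (y i)) i j)))).
  by [].
congr plug_family; apply/funext => i.
congr plug_family; apply/funext => j.
rewrite tagnat.RankEsum; congr (z (_ + j)%N).
by rewrite (big_ord_widen _ (fun l => arity (y l)) (ltnW (ltn_ord i))).
Qed.

Lemma ideal_plug (I : operad_ideal O) X z :
  I _ (tagged X) -> I _ (tagged (plug X z)).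
Proof. exact: ideal_compl. Qed.

(** Projects back to a fixed arity; the value 0 in the other arities keeps the
    map total, and linear in the operation plugged into. *)
Definition value m (X : operation) : P m :=
  if tag X =P m is ReflectT e then cast_arity (P := P) e (tagged X) else 0.

Lemma op_value m X : arity X = m -> op (value m X) = X.
Proof.
rewrite /value; case: eqP => // e _; rewrite op_cast.
by case: X e.
Qed.

Lemma value_null m X : null X -> value m X = 0.
Proof.
case: X => n x; rewrite /null /value /= => ->.
by case: eqP => // e; case: _ / e.
Qed.

Lemma ideal_value (I : operad_ideal O) m X :
  I _ (tagged X) -> I m (value m X).
Proof.
case: X => n x; rewrite /value /=.
by case: eqP => [e|_ _]; [case: _ / e | apply: ideal0].
Qed.

Lemma value_plug_linear n m (z : nat -> operation) :
  linear (fun x : P n => value m (plug (op x) z)).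
Proof.
move=> c x y; rewrite /value /plug /plug_family /= operad_comp_linearl.
case: eqP => [e|_]; first by case: _ / e.
by rewrite scaler0 addr0.
Qed.

Lemma plug0 n z : null (plug (op (0 : P n)) z).
Proof. exact: operad_comp0l. Qed.

End Operations.

(** * Closing and doubling an input *)

Section Units.
Variables (k : fieldType) (P : nat -> lmodType k) (O : operad P).
Variables (one0 : P 0%N) (one2 : P 2).
Hypothesis left_unit :
  comp2 O one2 one0 (operad_one O) = operad_one O.

Local Notation one := (op (operad_one O)).
Local Notation plug := (plug O).

Definition units_except (j : nat) (Y : operation P) (i : nat) : operation P :=
  if i == j then Y else one.

Lemma plug_nullary n (x : P n) z : n = 0%N -> plug (op x) z = op x.
Proof.
by move=> n0; rewrite -[RHS](plug_one O); apply: eq_plug; rewrite /= n0.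
Qed.

(** Associativity extends the unit law from 1 to any operation fed to the
    second input. *)
Lemma plug_two z : z 0%N = op one0 -> plug (op one2) z = z 1%N.
Proof.
have two1 : plug (op one2) (units_except 0 (op one0)) = one.
  rewrite -[RHS](congr1 (@op _ _ _) left_unit) op_cast.
  transitivity (plug_family O one2 (fun i : 'I_2 =>
      op (pair_op one0 (operad_one O) i))); last by [].
  congr plug_family; apply/funext => i.
  by rewrite /units_except /pair_op /arity2 -val_eqE /=; case: (_ == _).
move=> z0; rewrite -[RHS](one_plug O (fun i => z i.+1)) -two1 plugA.
apply: eq_plug => -[|[|//]] _ /=.
  by rewrite plug_nullary.
by rewrite big_ord1 /units_except /= (one_plug O (fun i => z (0 + i).+1)).
Qed.

Lemma sum_units_except j Y i :
  (\sum_(l < i) arity (units_except j Y l))%N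
  = if (i <= j)%N then i else (i.-1 + arity Y)%N.
Proof.
elim: i => [|i IH]; first by rewrite big_ord0.
rewrite big_ord_recr /= IH /units_except.
have [->|ne] := eqVneq i j; first by rewrite leqnn ltnn.
rewrite [in RHS]ltn_neqAle ne /= addn1; case: leqP => //= ji.
by rewrite -addSn prednK // (leq_ltn_trans _ ji).
Qed.

(** Plugging [Y] at input [j] replaces this input by a block of
    [arity Y] consecutive inputs. *)
Lemma plug_units_except X j Y z :
  plug (plug X (units_except j Y)) z
  = plug X (fun i =>
      if (i < j)%N then z i
      else if i == j then plug Y (fun l => z (j + l)%N)
      else z (i.-1 + arity Y)%N).
Proof.
rewrite plugA; apply: eq_plug => i _; rewrite sum_units_except /units_except.
by have [lij|lji|->] := ltngtP i j; rewrite ?one_plug ?addn0.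
Qed.

Lemma arity_plug_units_except X j Y : (j < arity X)%N ->
  arity (plug X (units_except j Y)) = ((arity X).-1 + arity Y)%N.
Proof. by move=> jX; rewrite arity_plug sum_units_except leqNgt jX. Qed.

Definition close_input n j (x : P n.+1) : P n :=
  value n (plug (op x) (units_except j (op one0))).

Definition double_input n j (x : P n.+1) : P n.+2 :=
  value n.+2 (plug (op x) (units_except j (op one2))).

Lemma op_close_input n j (x : P n.+1) : (j <= n)%N ->
  op (close_input j x) = plug (op x) (units_except j (op one0)).
Proof. by move=> jn; rewrite op_value // arity_plug_units_except //= addn0. Qed.

Lemma op_double_input n j (x : P n.+1) : (j <= n)%N ->
  op (double_input j x) = plug (op x) (units_except j (op one2)).
Proof. by move=> jn; rewrite op_value // arity_plug_units_except //= addn2. Qed.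

(** Feeding 1_0 to the first of the two inputs created by 1_2 leaves the
    identity there. *)
Lemma close_double_input n j (x : P n.+1) : (j <= n)%N ->
  close_input j (double_input j x) = x.
Proof.
move=> jn; apply: op_inj.
rewrite op_close_input ?op_double_input ?(leqW jn) // plug_units_except.
rewrite -[RHS](plug_one O).
apply: eq_plug => i _; rewrite /units_except.
have [//|ji|_] := ltngtP i j; first by case: eqP => //=; lia.
by rewrite plug_two ?addn0 ?eqxx // -[X in _ == X]addn0 eqn_add2l.
Qed.

Definition vanishes_at (i : nat) (X : operation P) : Prop :=
  forall z, z i = op one0 -> null (plug X z).

Definition vanishes_below (j : nat) (X : operation P) : Prop :=
  forall i, (i < j)%N -> vanishes_at i X.

(** A family with 1_0 at position [i] factors through [close_input i]: omit
    the entry [i] and shift the later ones. *)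
Lemma close_input_eq0 n i (x : P n.+1) : (i <= n)%N ->
  close_input i x = 0 <-> vanishes_at i (op x).
Proof.
move=> lin; split=> [xi0 z zi|]; last first.
  move=> /(_ (units_except i (op one0))) xi.
  by apply/value_null/xi; rewrite /units_except eqxx.
have -> : plug (op x) z
    = plug (op (close_input i x)) (fun l => z (if (l < i)%N then l else l.+1)).
  rewrite op_close_input // plug_units_except; apply: eq_plug => l _.
  have [//|il|->] := ltngtP l i; last by rewrite plug_nullary.
  by case: l il => // l il; rewrite /= addn0 ltnNge -ltnS il.
by rewrite xi0; apply: plug0.
Qed.

(** Inputs before [j] keep their positions when input [j] is closed or
    doubled. *)
Lemma vanishes_below_close_input n j (x : P n.+2) : (j <= n.+1)%N ->
  vanishes_below j (op x) -> vanishes_below j (op (close_input j x)).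
Proof.
move=> jn x0 i ij z zi; rewrite op_close_input // plug_units_except.
by apply: (x0 i ij); rewrite ij.
Qed.

Lemma vanishes_below_double_input n j (x : P n.+1) : (j <= n)%N ->
  vanishes_below j (op x) -> vanishes_below j (op (double_input j x)).
Proof.
move=> jn x0 i ij z zi; rewrite op_double_input // plug_units_except.
by apply: (x0 i ij); rewrite ij.
Qed.

Lemma vanishes_atB n (x y : P n) i :
  vanishes_at i (op x) -> vanishes_at i (op y) -> vanishes_at i (op (x - y)).
Proof.
move=> x0 y0 z zi; move: (x0 z zi) (y0 z zi).
rewrite /null /= -scaleN1r addrC operad_comp_linearl => -> ->.
by rewrite scaler0 addr0.
Qed.

Lemma close_inputB n j (x y : P n.+1) :
  close_input j (x - y) = close_input j x - close_input j y.
Proof.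
rewrite -scaleN1r addrC /close_input value_plug_linear.
by rewrite scaleN1r addrC.
Qed.

(** The operations in question have arity [n + 1] and only their first [n]
    inputs are constrained.  The last input stays free, so that an input being
    closed is always followed by another one, which can be doubled. *)
Definition depth_at_most N : Prop := forall n (x : P n.+1),
  (N <= n)%N -> vanishes_below n (op x) -> x = 0.

(** For [x] in [J] with its first [j] inputs constrained, write
    [x = (x - d (c x)) + d (c x)] with [c], [d] closing and doubling input [j].
    Both [c x] and the first term are in [J] and have one free input fewer than
    [x], so by induction they lie in [I].  With a single free input left, either
    the depth bound makes [x] zero or its arity is at most [N]. *)
Lemma ideal_determined N (I J : operad_ideal O) :
  depth_at_most N ->
  ideal_sub I J -> (forall n (x : P n), (n <= N)%N -> J n x -> I n x) ->
  ideal_sub J I.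
Proof.
move=> depth IJ low.
suff main t : forall n j, n = (j + t)%N -> forall x : P n.+1,
    vanishes_below j (op x) -> J _ x -> I _ x.
  by case=> [|n] x Jx; [apply: low | apply: (main n n 0%N)].
elim: t => [|t IH] n j en x xj Jx.
  rewrite addn0 in en; case: (leqP N n) => [Nn|nN]; last exact: low.
  by rewrite -en in xj; rewrite (depth n x Nn xj); apply: ideal0.
have jn : (j <= n)%N by lia.
case: n en x xj Jx jn => [|n] en x xj Jx jn; first by lia.
have jn' : (j <= n)%N by lia.
have Icx : I _ (close_input j x).
  apply: (IH n j) => //; [by lia | exact: vanishes_below_close_input |].
  exact/ideal_value/ideal_plug.
have Idx : I _ (double_input j (close_input j x)) by exact/ideal_value/ideal_plug.
suff Ir : I _ (x - double_input j (close_input j x)).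
  rewrite -[x](subrK (double_input j (close_input j x))) -[_ - _]scale1r.
  exact: ideal_linear.
apply: (IH n.+1 j.+1); first by lia.
  move=> i; rewrite ltnS leq_eqVlt => /orP[/eqP->|ij].
    by apply/close_input_eq0 => //; rewrite close_inputB close_double_input ?subrr.
  apply: vanishes_atB; first exact: xj.
  by apply: vanishes_below_double_input => //; apply: vanishes_below_close_input.
by rewrite addrC -scaleN1r; apply: ideal_linear => //; apply: IJ.
Qed.

End Units.

(** * Truncation ideals *)

Section Truncation.
Variables (k : fieldType) (P : nat -> lmodType k) (O : operad P).

Lemma operad_comp0r n (a : 'I_n -> nat) (x : P n) (y : forall i, P (a i)) i :
  y i = 0 -> operad_comp O x y = 0.
Proof.
move=> yi; have -> : y = eqtype.dfwith y (-1 *: 0 + 0 : P (a i)).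
  apply: functional_extensionality_dep => j.
  by case: eqtype.dfwithP; rewrite // yi scaler0 addr0.
by rewrite operad_comp_linearr scaleN1r addNr.
Qed.

Lemma operad_act0 n (s : 'S_n) : operad_act O 0 s = 0 :> P n.
Proof.
have := operad_act_linear O s (-1) (0 : P n) 0.
by rewrite !scaleN1r !addNr.
Qed.

Lemma cast_arity_eq0 m n (e : m = n) (x : P m) :
  cast_arity (P := P) e x = 0 <-> x = 0.
Proof. by case: _ / e. Qed.

(** In a unitary operad this is the intersection of the kernels of all
    restriction maps to fewer than [d] inputs. *)
Definition kills_low_arity (d n : nat) (x : P n) : Prop :=
  forall (a : 'I_n -> nat) (y : forall i, P (a i)),
    (\sum_i a i < d)%N -> operad_comp O x y = 0.

Program Definition truncation_ideal d : operad_ideal O :=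
  @OperadIdeal k P O (@kills_low_arity d) _ _ _ _ _.
Next Obligation. by move=> d n a y _; apply: operad_comp0l. Qed.
Next Obligation.
move=> d n c x x' x0 x'0 a y lt.
by rewrite operad_comp_linearl x0 // x'0 // scaler0 addr0.
Qed.
Next Obligation.
move=> d n x s x0 a y lt; rewrite operad_comp_actl x0 ?sum_perm //.
by rewrite (cast_arity_eq0 _ 0).2 ?operad_act0.
Qed.
Next Obligation.
move=> d n a x y x0 c z lt; apply/(cast_arity_eq0 (sum_Rank c)).
by rewrite operad_compA x0 -?sum_Rank.
Qed.
Next Obligation.
move=> d n a x y i yi0 c z lt; apply/(cast_arity_eq0 (sum_Rank c)).
rewrite operad_compA; apply: (@operad_comp0r _ _ _ _ i); apply: yi0.
apply: leq_ltn_trans lt; rewrite sum_Rank (bigD1 i) //=; exact: leq_addr.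
Qed.

(** Composing with identities has total arity [n] and recovers [x]. *)
Lemma kills_low_arity_eq0 d n (x : P n) : (n < d)%N -> kills_low_arity d x -> x = 0.
Proof.
move=> nd x0; rewrite -[x](operad_comp1r O).
by apply/cast_arity_eq0/x0; rewrite sum_ones.
Qed.

Lemma truncation_ideal_decr d : ideal_sub (truncation_ideal d.+1) (truncation_ideal d).
Proof. by move=> n x x0 a y lt; apply: x0; apply: leqW. Qed.

Variable one0 : P 0%N.
Hypothesis one0_spans : forall x : P 0%N, exists c : k, x = c *: one0.

(** A family of [n + 1] operations of total arity below [n] has a nullary
    member at one of the first [n] positions, and it is a multiple of 1_0. *)
Lemma vanishes_below_kills_low_arity n (x : P n.+1) :
  vanishes_below O one0 n (op x) -> kills_low_arity n x.
Proof.
move=> x0 a y lt.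
(* Otherwise the first n arities are positive and already add up to n. *)
have [i /andP[ilt /eqP ai0]] : exists i : 'I_n.+1, (i < n)%N && (a i == 0)%N.
  apply/existsP; apply: contraLR lt; rewrite -leqNgt negb_exists.
  move=> /forallP apos; rewrite big_ord_recr /= -[X in (X <= _)%N](sum_ones n).
  apply: leq_trans (leq_addr _ _); apply: leq_sum => i _.
  by have := apos (widen_ord (leqnSn n) i); rewrite /= ltn_ord /= lt0n.
have [c yi] : exists c : k, y i = c *: cast_arity (P := P) (esym ai0) one0.
  by move: (a i) ai0 (y i) => m e v; subst m; apply: one0_spans.
set u := cast_arity _ _ in yi.
have yE : y = eqtype.dfwith y (c *: u + 0).
  apply: functional_extensionality_dep => j.
  by case: eqtype.dfwithP; rewrite // yi addr0.
rewrite yE operad_comp_linearr.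
rewrite (@operad_comp0r _ _ _ (eqtype.dfwith y 0) i) ?eqtype.dfwith_in // addr0.
pose y' := eqtype.dfwith y u.
have -> : operad_comp O x y' = 0; last by rewrite scaler0.
have y'E : op (operad_comp O x y') = plug O (op x) (fun l => op (y' (inord l))).
  transitivity (plug_family O x (fun i => op (y' i))) => //.
  by congr plug_family; apply/funext => l; rewrite inord_val.
apply/(null_op (esym y'E))/(x0 i ilt).
rewrite inord_val /y' eqtype.dfwith_in; exact: op_cast.
Qed.

(** If the chain is stationary from [N] on, an element of the [N]-th ideal lies
    in all later ones, hence is zero. *)
Lemma artinian_depth : artinian O -> exists N, depth_at_most O one0 N.
Proof.
move=> art; have [N stat] := art truncation_ideal truncation_ideal_decr.
exists N => n x Nn /vanishes_below_kills_low_arity xn.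
apply: (@kills_low_arity_eq0 n.+2) => //.
apply/(stat n.+2); first by rewrite !leqW.
by move=> a y lt; apply: xn; apply: leq_trans lt Nn.
Qed.

End Truncation.

(** * Chains of subspaces of a finite-dimensional space *)

Lemma nondecreasing_bounded_stationary (f : nat -> nat) B :
  (forall m, f m <= f m.+1)%N -> (forall m, f m <= B)%N ->
  exists N, forall m, (N <= m)%N -> f m = f N.
Proof.
move=> /(homo_leq leqnn leq_trans) fi fB.
have : exists v, `[< exists m, f m = v >] by exists (f 0%N); apply/asboolP; exists 0%N.
move=> /(@ex_maxnP _ B) []; first by move=> v /asboolP[m <-].
move=> _ /asboolP[N <-] fN; exists N => m Nm; apply/eqP.
rewrite eqn_leq (fi N m Nm) andbT; apply: fN; apply/asboolP; by exists m.
Qed.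

Section Subspaces.
Variables (k : fieldType) (V : vectType k).

(** A subspace of largest dimension among the detachable ones contained in [Q]
    is all of [Q], since any further vector of [Q] could be added to it. *)
Lemma subspace_is_vspace (Q : V -> Prop) :
  Q 0 -> (forall (c : k) x y, Q x -> Q y -> Q (c *: x + y)) ->
  exists U : {vspace V}, forall x, x \in U <-> Q x.
Proof.
move=> Q0 Ql.
pose in_Q (U : {vspace V}) := forall x, x \in U -> Q x.
have : exists d, `[< exists2 U, in_Q U & \dim U = d >].
  exists 0%N; apply/asboolP; exists 0%VS; last exact: dimv0.
  by move=> x; rewrite memv0 => /eqP->.
move=> /(@ex_maxnP _ (\dim {:V})) [].
  by move=> _ /asboolP[U _ <-]; apply/dimvS/subvf.
move=> _ /asboolP[U UQ <-] Umax; exists U => x; split=> [/UQ //|Qx].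
apply/idPn => xU.
have /Umax : `[< exists2 W, in_Q W & \dim W = \dim (<[x]> + U)%VS >].
  apply/asboolP; exists (<[x]> + U)%VS => // y.
  by move=> /memv_addP[_ /vlineP[c ->] [u /UQ Qu ->]]; apply: Ql.
rewrite leqNgt => /negP[]; rewrite ltn_neqAle dimvS ?addvSr // andbT.
apply: contra xU => /eqP e.
have /eqP -> : U == (<[x]> + U)%VS by rewrite eqEdim addvSr e leqnn.
by apply: (subvP (addvSl _ _)); apply: memv_line.
Qed.

Variable Q : nat -> V -> Prop.
Hypothesis Q0 : forall m, Q m 0.
Hypothesis Ql : forall m (c : k) x y, Q m x -> Q m y -> Q m (c *: x + y).

Lemma ascending_subspaces_stationary :
  (forall m x, Q m x -> Q m.+1 x) ->
  exists N, forall m, (N <= m)%N -> forall x, Q m x <-> Q N x.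
Proof.
move=> Qi.
have /choice[U UQ] m := subspace_is_vspace (Q0 m) (@Ql m).
have Ui m : (U m <= U m.+1)%VS.
  by apply/subvP => x /UQ/Qi/UQ.
have [N UN] := nondecreasing_bounded_stationary
  (fun m => dimvS (Ui m)) (fun m => dimvS (subvf (U m))).
exists N => m Nm x; rewrite -!UQ; suff /eqP -> : U N == U m by [].
by rewrite eqEdim UN // leqnn (homo_leq (@subvv _ V) (@subv_trans _ V) Ui).
Qed.

Lemma descending_subspaces_stationary :
  (forall m x, Q m.+1 x -> Q m x) ->
  exists N, forall m, (N <= m)%N -> forall x, Q m x <-> Q N x.
Proof.
move=> Qd.
have /choice[U UQ] m := subspace_is_vspace (Q0 m) (@Ql m).
have Ud m : (U m.+1 <= U m)%VS.
  by apply/subvP => x /UQ/Qd/UQ.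
have [N UN] := @nondecreasing_bounded_stationary
  (fun m => \dim {:V} - \dim (U m))%N (\dim {:V})
  (fun m => leq_sub2l _ (dimvS (Ud m))) (fun m => leq_subr _ _).
exists N => m Nm x; rewrite -!UQ; suff /eqP -> : U m == U N by [].
rewrite eqEdim -(leq_sub2lE _ (dimvS (subvf _))) UN // leqnn andbT.
by apply: (homo_leq (r := fun A B => (B <= A)%VS) (@subvv _ V) _ Ud) => // A B C *;
   apply: subv_trans; eassumption.
Qed.

End Subspaces.

Lemma eventually_uniform (R : nat -> nat -> Prop) N :
  (forall n, exists M, forall m, (M <= m)%N -> R n m) ->
  exists M, forall n m, (n <= N)%N -> (M <= m)%N -> R n m.
Proof.
move=> /choice[M RM]; exists (\max_(n < N.+1) M n)%N => n m nN Mm.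
apply: RM; apply: leq_trans Mm; rewrite -ltnS in nN.
exact: (@leq_bigmax _ (fun i : 'I_N.+1 => M i) (Ordinal nN)).
Qed.

(** * Growth and chain conditions *)

Definition cumulative_dim (k : fieldType) (P : nat -> vectType k) n : nat :=
  (\sum_(i < n.+1) \dim {:P i})%N.

Lemma bin_leq_exp m n i : (m <= n)%N -> ('C(m, i) <= n ^ i)%N.
Proof.
move=> mn; elim: i => [|i IH]; first by rewrite bin0.
rewrite expnS (leq_trans (leq_pmull _ (ltn0Sn i))) // mul_bin_left.
by rewrite leq_mul // (leq_trans (leq_subr _ _)).
Qed.

Section Main.
Variables (k : fieldType) (P : nat -> vectType k).
Variable O : operad (fun n => P n : lmodType k).
Variables (one0 : P 0%N) (one2 : P 2).
Hypothesis left_unit :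
  comp2 O one2 one0 (operad_one O) = operad_one O.

Lemma depth_noetherian N : depth_at_most O one0 N -> noetherian O.
Proof.
move=> depth I Ii.
have IS : forall m m', (m <= m')%N -> ideal_sub (I m) (I m').
  apply: homo_leq Ii => [A n x|A B C BA AC n x] //.
  by move/BA/AC.
have [|M IM] := @eventually_uniform
    (fun n m => forall m', (m <= m')%N -> forall x : P n, I m' n x -> I m n x) N.
  move=> n.
  have [M IM] := ascending_subspaces_stationary
    (fun m => ideal0 (I m) n) (fun m => @ideal_linear _ _ _ (I m) n)
    (fun m => Ii m n).
  exists M => m Mm m' mm' x; move/(IM m' (leq_trans Mm mm')).
  by move/(IM m Mm).
exists M => m Mm n x; split; last exact: IS.
apply: (ideal_determined left_unit depth (IS _ _ Mm)) => {n x} n x nN.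
exact: (IM n M nN (leqnn M) m Mm).
Qed.

Lemma depth_artinian N : depth_at_most O one0 N -> artinian O.
Proof.
move=> depth I Id.
have IS : forall m m', (m <= m')%N -> ideal_sub (I m') (I m).
  apply: (homo_leq (r := fun A B => ideal_sub B A)) Id => [A n x|A B C AB CA n x] //.
  by move/CA/AB.
have [|M IM] := @eventually_uniform
    (fun n m => forall m', (m <= m')%N -> forall x : P n, I m n x -> I m' n x) N.
  move=> n.
  have [M IM] := descending_subspaces_stationary
    (fun m => ideal0 (I m) n) (fun m => @ideal_linear _ _ _ (I m) n)
    (fun m => Id m n).
  exists M => m Mm m' mm' x; move/(IM m Mm).
  by move/(IM m' (leq_trans Mm mm')).
exists M => m Mm n x; split; first exact: IS.
apply: (ideal_determined left_unit depth (IS _ _ Mm)) => {n x} n x nN.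
exact: (IM n M nN (leqnn M) m Mm).
Qed.

Local Notation opP := (op (P := fun n => P n : lmodType k)).

HB.instance Definition _ n j := GRing.isLinear.Build k (P n.+1) (P n) *:%R
   (close_input O one0 j) (value_plug_linear O n (units_except O j (op one0))).

Definition vanishing_space n j : {vspace P n.+1} :=
  (\bigcap_(i < j) lker (linfun (close_input O one0 i) : 'Hom(P n.+1, P n)))%VS.

Lemma mem_vanishing_space n j (x : P n.+1) : (j <= n.+1)%N ->
  x \in vanishing_space n j <-> vanishes_below O one0 j (opP x).
Proof.
move=> jn; rewrite memvE /vanishing_space; split=> [/subv_bigcapP xj i ij|xj].
  apply/close_input_eq0; first by rewrite -ltnS (leq_trans ij).
  have := xj (Ordinal ij) isT.
  by rewrite -memvE memv_ker lfunE => /eqP.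
apply/subv_bigcapP => i _; rewrite -memvE memv_ker lfunE; apply/eqP.
apply/close_input_eq0; last exact: xj.
by rewrite -ltnS (leq_trans (ltn_ord i)).
Qed.

(** A number rather than a space, so that [n] and [j] can be rewritten. *)
Definition vanishing_dim n j : nat := \dim (vanishing_space n j).

Lemma vanishing_dim_eq0 n (x : P n.+1) :
  vanishing_dim n n = 0%N -> vanishes_below O one0 n (opP x) -> x = 0.
Proof.
move=> /eqP; rewrite dimv_eq0 => /eqP n0 /(mem_vanishing_space x (leqnSn n)).
by rewrite n0 memv0 => /eqP.
Qed.

Lemma depth_vanishing_dim N n :
  depth_at_most O one0 N -> (N <= n)%N -> vanishing_dim n n = 0%N.
Proof.
move=> depth Nn; apply/eqP; rewrite dimv_eq0 -subv0; apply/subvP => x.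
by move=> /(mem_vanishing_space x (leqnSn n))/(depth n x Nn)->; apply: mem0v.
Qed.

(** Rank-nullity for closing input [j]: doubling shows that it is onto, and the
    constraint at [j] is exactly membership in its kernel. *)
Lemma vanishing_dim_pascal n j : (j <= n)%N ->
  vanishing_dim n.+1 j
  = (vanishing_dim n.+1 j.+1 + vanishing_dim n j)%N.
Proof.
move=> jn; pose c : 'Hom(P n.+2, P n.+1) := linfun (close_input O one0 j).
rewrite /vanishing_dim -(limg_ker_dim c); congr (_ + _)%N.
  by rewrite /vanishing_space big_ord_recr.
congr (\dim _); apply/eqP; rewrite eqEsubv; apply/andP; split; apply/subvP.
  move=> _ /memv_imgP[x xj ->]; rewrite lfunE.
  apply/mem_vanishing_space; first by rewrite leqW.
  apply: vanishes_below_close_input; first exact: leqW.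
  by apply/mem_vanishing_space => //; rewrite !leqW.
move=> x xj; apply/memv_imgP; exists (double_input O one2 j x).
  apply/mem_vanishing_space; first by rewrite !leqW.
  apply: vanishes_below_double_input => //.
  by apply/mem_vanishing_space => //; rewrite leqW.
by rewrite lfunE /= (close_double_input left_unit).
Qed.

Lemma vanishing_dim_binomial t j :
  vanishing_dim (j + t) j
  = (\sum_(i < t.+1) 'C(t, i) * vanishing_dim (j + i) (j + i))%N.
Proof.
elim: t j => [|t IH] j; first by rewrite big_ord1 addn0 mul1n.
rewrite addnS vanishing_dim_pascal ?leq_addr // -addSn !IH.
rewrite [RHS]big_ord_recl bin0 mul1n.
rewrite [X in (_ + X)%N]big_ord_recl bin0 mul1n addnCA; congr (_ + _)%N.
under [in RHS]eq_bigr do rewrite lift0 binS mulnDl addnS -addSn.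
rewrite big_split /= addnC; congr (_ + _)%N.
rewrite [RHS]big_ord_recr /= bin_small // addn0.
by apply: eq_bigr => i _; rewrite /bump /= add1n addnS -addSn.
Qed.

Lemma dim_operad_binomial n :
  \dim {:P n.+1} = (\sum_(i < n.+1) 'C(n, i) * vanishing_dim i i)%N.
Proof.
rewrite -[RHS](vanishing_dim_binomial n 0); congr (\dim _).
by rewrite /vanishing_space big_ord0.
Qed.

(** Only the binomials [C(n, i)] with [i < N] survive, each at most [n ^ N]. *)
Lemma depth_polynomial N : depth_at_most O one0 N ->
  exists M, forall n, (1 < n)%N -> (cumulative_dim P n <= n ^ M)%N.
Proof.
move=> /depth_vanishing_dim depth.
pose G := (\dim {:P 0%N} + \sum_(i < N) vanishing_dim i i)%N.
have dimP n m : (m <= n)%N -> (0 < n)%N -> (\dim {:P m} <= G * n ^ N)%N.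
  case: m => [|m] mn n0.
    by rewrite (leq_trans (leq_addr _ _ : _ <= G)%N) // leq_pmulr // expn_gt0 n0.
  rewrite dim_operad_binomial.
  apply: (@leq_trans (\sum_(i < N) vanishing_dim i i * n ^ N)%N).
    rewrite (big_ord_widen (m.+1 + N) (fun i => 'C(m, i) * vanishing_dim i i)%N
      (leq_addr _ _)).
    rewrite (big_ord_widen (m.+1 + N) (fun i => vanishing_dim i i * n ^ N)%N
      (leq_addl _ _)).
    rewrite big_mkcond [leqRHS]big_mkcond; apply: leq_sum => i _.
    case: ifP => // _; case: (ltnP i N) => [iN|/depth->]; last by rewrite muln0.
    rewrite mulnC leq_mul2l (leq_trans (bin_leq_exp _ (ltnW mn))) ?orbT //.
    by rewrite leq_pexp2l // ltnW.
  by rewrite -big_distrl leq_mul2r leq_addl orbT.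
(* G <= n ^ G turns the constant factor into a power, and n + 1 <= n ^ 2. *)
move: G dimP => G dimP; exists (G + N + 2)%N => n n1.
apply: (@leq_trans (\sum_(i < n.+1) G * n ^ N)%N).
  by apply: leq_sum => i _; apply: dimP; [rewrite -ltnS | apply: ltnW].
rewrite sum_nat_const card_ord mulnC !expnD; apply: leq_mul; last by nia.
by apply: leq_mul => //; apply/ltnW; apply: ltn_expl.
Qed.

(** If [V(m, m)] is nonzero then [C(n, m)], of degree [m] in [n], is a lower
    bound for the dimension in arity [n + 1], which excludes a bound of degree
    [M < m]. *)
Lemma polynomial_depth M n0 :
  (forall n, (n0 <= n)%N -> (cumulative_dim P n <= n ^ M)%N) ->
  forall m, (M < m)%N -> vanishing_dim m m = 0%N.
Proof.
move=> poly m Mm; apply/eqP; rewrite eqn0Ngt; apply/negP => g0.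
(* In arity p + m + 1 <= 2 p the two bounds give p ^ m <= m! * (2 p) ^ M,
   hence p <= m! * 2 ^ M. *)
pose p := (m`! * 2 ^ M + m + n0 + 1)%N.
have low : ('C(p + m, m) <= (p + m).+1 ^ M)%N.
  apply: leq_trans (poly _ _); last by rewrite /p; lia.
  rewrite /cumulative_dim big_ord_recr /= dim_operad_binomial.
  apply: leq_trans (leq_addl _ _).
  have mp : (m < (p + m).+1)%N by rewrite ltnS leq_addl.
  by rewrite (bigD1 (Ordinal mp)) //= (leq_trans _ (leq_addr _ _)) // leq_pmulr.
have ffact : (p ^ m <= (p + m) ^_ m)%N.
  elim: (m) => [|r IH]; first by rewrite ffactn0.
  by rewrite addnS ffactSS expnS leq_mul // leqW ?leq_addr.
have : (p ^ m <= m`! * (2 ^ M * p ^ M))%N.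
  rewrite (leq_trans ffact) // -bin_ffact mulnC leq_mul2l (leq_trans low) ?orbT //.
  rewrite -expnMn; case: (posnP M) => [->|M0]; first by rewrite !expn0.
  by rewrite leq_exp2r // /p; lia.
apply/negP; rewrite -ltnNge.
have p0 : (0 < p)%N by rewrite /p addn1.
apply: (@leq_trans (p ^ M.+1)); last by rewrite leq_pexp2l.
rewrite expnS mulnA ltn_pmul2r ?expn_gt0 ?p0 // /p; lia.
Qed.

End Main.

(** The inequality [ln S / ln n <= M] says [S <= n ^ M] as soon as [n >= 2]. *)
Lemma GKdim_lt_pinfty (R : realType) (k : fieldType) (P : nat -> vectType k) :
  (GKdim R P < +oo)%E <->
  exists M n0, forall n, (n0 <= n)%N -> (cumulative_dim P n <= n ^ M)%N.
Proof.
rewrite /GKdim /limn_esup /limf_esup; split.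
  move=> /ereal_inf_lt[_ [V [n1 _ Vn1] <-] Vfin].
  have [M VM] : exists M, forall n, V n ->
      (ln (cumulative_dim P n)%:R / ln n%:R <= M%:R :> R)%R.
    set f := (fun n => _) in Vfin.
    have ub n : V n -> (f n <= ereal_sup (f @` V))%E.
      by move=> Vn; apply: ereal_sup_ubound; exists n.
    case: (ereal_sup _) Vfin ub => [r _ ub||_ ub] //.
      exists (Num.truncn r).+1 => n /ub; rewrite /f lee_fin => /le_trans; apply.
      by apply: ltW; apply: truncnS_gt.
    by exists 0%N => n /ub.
  exists M, (maxn n1 2) => n; rewrite geq_max => /andP[n1n n2].
  have := VM n (Vn1 n n1n).
  have lnn : (0 < ln n%:R :> R)%R by rewrite ln_gt0 // ltr1n.
  rewrite ler_pdivrMr // mulr_natl -lnXn ?ltr0n ?(ltnW n2) //.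
  case: (posnP (cumulative_dim P n)) => [->//|d0].
  by rewrite ler_ln ?posrE ?exprn_gt0 ?ltr0n ?(ltnW n2) // -natrX ler_nat.
move=> [M [n0 bd]].
pose f n : \bar R := (ln (cumulative_dim P n)%:R / ln n%:R)%:E.
apply: (@le_lt_trans _ _ (ereal_sup (f @` [set n | (maxn n0 2 <= n)%N]%classic))).
  apply: ereal_inf_lbound; exists [set n | (maxn n0 2 <= n)%N]%classic => //.
  exact: nbhs_infty_ge.
apply: (@le_lt_trans _ _ (M%:R)%:E); last exact: ltry.
apply: ge_ereal_sup => _ [n /= + <-]; rewrite geq_max => /andP[n0n n2].
have lnn : (0 < ln n%:R :> R)%R by rewrite ln_gt0 // ltr1n.
rewrite /f lee_fin ler_pdivrMr // mulr_natl -lnXn ?ltr0n ?(ltnW n2) //.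
have := bd n n0n; rewrite -/(cumulative_dim P n).
case: (posnP (cumulative_dim P n)) => [->//|d0] le.
  by rewrite ln0 // ln_ge0 // -natrX ler1n expn_gt0 (ltnW n2).
by rewrite ler_ln ?posrE ?exprn_gt0 ?ltr0n ?(ltnW n2) // -natrX ler_nat.
Qed.

Theorem theorem0p3 (R : realType) (k : fieldType) (P : nat -> vectType k)
    (O : operad (fun n => P n : lmodType k)) (hO : two_unitary O) :
  [/\ (GKdim R P < +oo)%E -> noetherian O,
      (GKdim R P < +oo)%E <-> artinian O
    & artinian O -> noetherian O].
Proof.
case: hO => one0 [one2 [one0_basis left_unit _]].
have one0_spans (x : P 0%N) : exists c : k, x = c *: one0.
  by have [c [xE _]] := one0_basis x; exists c.
have GK_depth : (GKdim R P < +oo)%E -> exists N, depth_at_most O one0 N.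
  move=> /GKdim_lt_pinfty[M [n0 poly]]; exists M.+1 => n x Mn xn.
  have := polynomial_depth left_unit poly Mn.
  by move=> /vanishing_dim_eq0; apply.
have depth_GK : (exists N, depth_at_most O one0 N) -> (GKdim R P < +oo)%E.
  move=> [N depth]; apply/GKdim_lt_pinfty.
  have [M poly] := depth_polynomial left_unit depth.
  by exists M, 2%N.
have artin_depth : artinian O -> exists N, depth_at_most O one0 N.
  exact: (artinian_depth one0_spans).
have depth_noeth : (exists N, depth_at_most O one0 N) -> noetherian O.
  by case=> N; apply: (depth_noetherian left_unit).
split=> [/GK_depth/depth_noeth//| |/artin_depth/depth_noeth//].
split=> [/GK_depth[N]|/artin_depth/depth_GK//].
exact: (depth_artinian left_unit).
Qed.
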